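(* Let $\mathbb F$ be a field of characteristic $0$. Let $H$ be a twin-free $\mathbb F$-weighted graph (directed or undirected) and $k \ge 0$. Then the column space of $N(k, H)$ (the set of finite linear combinations of its columns) consists of precisely those vectors $f \colon V(H)^k \to \mathbb F$ that are invariant under the automorphisms of $H$, i.e. satisfy $f(\sigma\circ\varphi)=f(\varphi)$ for all $\sigma\in\operatorname{Aut}(H)$ and $\varphi\in V(H)^k$. Moreover, every such vector is a finite linear combination of columns of $N(k, H)$ indexed by elements of $\mathcal{PLG}^{\mathrm{simp}}[k]$.
   Context: An $\mathbb F$-weighted graph $H$ consists of a finite vertex set $V(H)$, vertex weights $\alpha_H(i)\in\mathbb F\setminus\{0\}$ and edge weights $\beta_H(i,j)\in\mathbb F$ for all ordered pairs $(i,j)$ (symmetric if undirected). $H$ is twin-free if there are no distinct $i,j$ with $\beta_H(i,\ell)=\beta_H(j,\ell)$ and $\beta_H(\ell,i)=\beta_H(\ell,j)$ for all $\ell$. $\operatorname{Aut}(H)$ is the group of bijections of $V(H)$ preserving all vertex and edge weights. $V(H)^k$ denotes the set of maps $[k]\to V(H)$. A $k$-labeled graph is a finite graph (directed iff $H$ is), without loops but possibly with multiple edges, with $k$ distinct nodes labeled $1,\dots,k$; $\mathcal{PLG}[k]$ is the set of their isomorphism classes, and $\mathcal{PLG}^{\mathrm{simp}}[k]$ the subset of simple ones: no loops, at most one edge between any two vertices (in the directed case not both directions), no edge between labeled vertices. For $\varphi\colon[k]\to V(H)$, $\hom_\varphi(G,H)=\sum_{\phi}\prod_{u\text{ unlabeled}}\alpha_H(\phi(u))\prod_{uv\in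 E(G)}\beta_H(\phi(u),\phi(v))$ over $\phi\colon V(G)\to V(H)$ mapping the node labeled $i$ to $\varphi(i)$ (edges with multiplicity; directed edge $u\to v$ gives $\beta_H(\phi(u),\phi(v))$; $0^0=1$). $N(k,H)$ is the matrix with rows indexed by $V(H)^k$, columns indexed by $\mathcal{PLG}[k]$, and $(\varphi,G)$-entry $\hom_\varphi(G,H)$. *)

(* Defs.v *)
From mathcomp Require Import all_boot all_order all_algebra all_fingroup.
Set Implicit Arguments.
Unset Strict Implicit.
Unset Printing Implicit Defensive.
Import GRing.Theory.
Local Open Scope ring_scope.

(* Throughout, the boolean [d] records the orientation convention: [d = true]
   is the directed setting, [d = false] the undirected one. *)
Record wgraph (F : fieldType) (d : bool) := WGraph {
  wvert :> finType;
  vweight : wvert -> F;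
  eweight : wvert -> wvert -> F;
  vweight_neq0 : forall i, vweight i != 0;
  eweight_sym : ~~ d -> forall i j, eweight i j = eweight j i
}.

Definition twin_free (F : fieldType) (d : bool) (H : wgraph F d) : Prop :=
  ~ exists i j : H,
      [/\ i <> j,
          forall l : H, eweight i l = eweight j l
        & forall l : H, eweight l i = eweight l j].

Definition waut (F : fieldType) (d : bool) (H : wgraph F d) : {set {perm H}} :=
  [set s : {perm H} | [forall i, vweight (s i) == vweight i]
      && [forall i, forall j, eweight (s i) (s j) == eweight i j]].

(* [mult u v] is the number of edges from [u] to [v] if [d = true], and the
   number of edges between [u] and [v] if [d = false]. *)
Record lgraph (d : bool) (k : nat) := LGraph {
  node :> finType;
  label : 'I_k -> node;
  mult : node -> node -> nat;
  label_inj : injective label;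
  mult_loopless : forall u, mult u u = 0%N;
  mult_sym : ~~ d -> forall u v, mult u v = mult v u
}.
Arguments label {d k} l _.
Arguments mult {d k} l _ _.

Definition simple_lgraph (d : bool) (k : nat) (G : lgraph d k) : Prop :=
  (if d then forall u v : G, (mult G u v + mult G v u <= 1)%N
        else forall u v : G, (mult G u v <= 1)%N)
  /\ forall i j : 'I_k, mult G (label G i) (label G j) = 0%N.

(* Products over the edges of an undirected graph run over the pairs [(u, v)]
   with [u] before [v] in [enum G], so that each unordered pair counts once;
   as edge weights are then symmetric, this choice is immaterial
   (see [lgraph_iso_hom]). *)
Definition edge_slot (d : bool) (T : finType) (e : T * T) : bool :=
  d || (enum_rank e.1 < enum_rank e.2)%N.

Definition hom (F : fieldType) (d : bool) (H : wgraph F d) (k : nat)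
    (phi : {ffun 'I_k -> H}) (G : lgraph d k) : F :=
  \sum_(psi : {ffun G -> H} | [forall i, psi (label G i) == phi i])
    (\prod_(u : G | u \notin codom (label G)) vweight (psi u))
    * \prod_(e : G * G | edge_slot d e)
        eweight (psi e.1) (psi e.2) ^+ mult G e.1 e.2.

(* The columns of [Nmx] are indexed by labeled graphs rather than by their
   isomorphism classes: isomorphic graphs yield the same column
   ([lgraph_iso_hom]), so the set of columns is that of the matrix indexed by
   classes. *)
Definition Nmx (F : fieldType) (d : bool) (k : nat) (H : wgraph F d)
    (phi : {ffun 'I_k -> H}) (G : lgraph d k) : F := hom phi G.

Definition column_combination (F : fieldType) (R C : Type) (M : R -> C -> F)
    (P : C -> Prop) (f : R -> F) : Prop :=
  exists (n : nat) (c : 'I_n -> F) (g : 'I_n -> C),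
    (forall i, P (g i)) /\ forall r, f r = \sum_(i < n) c i * M r (g i).

Definition column_space (F : fieldType) (R C : Type) (M : R -> C -> F)
    (f : R -> F) : Prop := column_combination M (fun=> True) f.

Definition aut_invariant (F : fieldType) (d : bool) (H : wgraph F d) (k : nat)
    (f : {ffun 'I_k -> H} -> F) : Prop :=
  forall s : {perm H}, s \in waut H ->
  forall phi : {ffun 'I_k -> H}, f [ffun i => s (phi i)] = f phi.

Definition lgraph_iso (d : bool) (k : nat) (G G' : lgraph d k) : Prop :=
  exists h : G -> G',
    [/\ bijective h, forall i, h (label G i) = label G' i
      & forall u v, mult G' (h u) (h v) = mult G u v].

Lemma waut_group_set (F : fieldType) (d : bool) (H : wgraph F d) :
  group_set (waut H).
Proof.
apply/group_setP; split=> [|s t].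
  by rewrite inE; apply/andP; split; apply/forallP=> i;
     [|apply/forallP=> j]; rewrite !perm1.
rewrite !inE => /andP[/forallP sv /forallP se] /andP[/forallP tv /forallP te].
apply/andP; split; apply/forallP=> i.
  by rewrite permM (eqP (tv _)) (eqP (sv _)).
apply/forallP=> j; rewrite !permM (eqP (forallP (te _) _)).
by rewrite (eqP (forallP (se _) _)).
Qed.

Canonical waut_group (F : fieldType) (d : bool) (H : wgraph F d) :=
  Group (waut_group_set H).

Lemma prod_pair_order (F : fieldType) (T : finType) (r r' : T -> nat)
    (g : T * T -> F) :
    injective r -> injective r' -> (forall u v, g (u, v) = g (v, u)) ->
  \prod_(e : T * T | (r e.1 < r e.2)%N) g e
    = \prod_(e : T * T | (r' e.1 < r' e.2)%N) g e.
Proof.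
move=> rI r'I gC.
rewrite (bigID (fun e : T * T => (r' e.1 < r' e.2)%N)) /=.
rewrite [RHS](bigID (fun e : T * T => (r e.1 < r e.2)%N)) /=.
congr (_ * _); first by apply: eq_bigl => e; rewrite andbC.
pose sw (e : T * T) := (e.2, e.1).
have swK : involutive sw by case.
rewrite (reindex_inj (inv_inj swK)) /=.
apply: eq_big => [[u v]|[u v] _] /=; last exact: gC.
rewrite -!leqNgt; have [->|neq_uv] := eqVneq u v.
  by rewrite !ltnn.
rewrite andbC; congr (_ && _); last first.
  by rewrite [RHS]leq_eqVlt (inj_eq rI) eq_sym (negPf neq_uv).
by rewrite leq_eqVlt (inj_eq r'I) (negPf neq_uv).
Qed.

Lemma lgraph_iso_hom (F : fieldType) (d : bool) (H : wgraph F d) (k : nat)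
    (phi : {ffun 'I_k -> H}) (G G' : lgraph d k) :
  lgraph_iso G G' -> hom phi G = hom phi G'.
Proof.
case=> h [[h' hK h'K] hl hm]; rewrite /hom.
pose a (p : {ffun G' -> H}) : {ffun G -> H} := [ffun u => p (h u)].
pose b (p : {ffun G -> H}) : {ffun G' -> H} := [ffun u => p (h' u)].
rewrite (reindex a) /=; last first.
  by exists b => p _; apply/ffunP=> u; rewrite !ffunE ?hK ?h'K.
apply: eq_big => [p|p _].
  by apply: eq_forallb => i; rewrite ffunE hl.
congr (_ * _).
  rewrite [RHS](reindex h) /=; last by exists h' => u _.
  apply: eq_big => [u|u _]; last by rewrite ffunE.
  congr (~~ _); apply/codomP/codomP => -[i]; rewrite -?hl.
    by move=> ->; exists i; rewrite hl.
  by move/(can_inj hK)=> ->; exists i.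
pose h2 (e : G * G) := (h e.1, h e.2).
rewrite [RHS](reindex h2) /=; last first.
  by exists (fun e => (h' e.1, h' e.2)) => -[u v] _; rewrite /h2 /= ?hK ?h'K.
under eq_bigr => e _ do rewrite !ffunE -hm.
rewrite {a b}/h2 /edge_slot /= {h2}.
case: d H phi G G' h h' hK h'K hl hm p
  => H phi G G' h h' hK h'K hl hm p //=.
apply: (prod_pair_order (r := fun u : G => enum_rank u)
          (r' := fun u : G => enum_rank (h u))
          (g := fun e => eweight (p (h e.1)) (p (h e.2))
                  ^+ mult G' (h e.1) (h e.2))) => [u v|u v|u v] /=.
- by move/val_inj/enum_rank_inj.
- by move/val_inj/enum_rank_inj/(can_inj hK).
- by rewrite eweight_sym // mult_sym.
Qed.

(* Main.v *)
(* Let [A_L] be the span of the columns of simple [L]-labelled graphs.  Gluing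
   along labels makes it a unital subalgebra of the functions on [H ^ L], so it
   consists of all functions constant on the classes of the relation "not
   separated by [A_L]" ([indist]); these classes have to be shown to be orbits
   of [Aut(H)].

   If a labelling [phi] is such that all its one-point extensions are separated
   ([distinguishing]), unlabelling the class indicator of [(phi, v)] gives
   [vweight v <> 0], so every [psi] indistinguishable from [phi] has a unique
   matching extension [(psi, s v)], and [s] is an automorphism with
   [psi = s \o phi].  Twin-freeness yields labels [eta] such that [(phi, eta)]
   is distinguishing for every [phi]: star graphs attached to them interpolate
   the indicator of each vertex.

   For arbitrary [phi], unlabel [eta] in the class indicator of [(phi, eta)].
   By the previous case the surviving terms at [phi] are the weights of
   translates of [eta] by automorphisms, so they are all equal and nonzero, and
   in characteristic 0 they cannot cancel.  Hence the value at an
   indistinguishable [psi] is nonzero too, some [(psi, eta')] lies in the class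
   of [(phi, eta)], and the previous case applies. *)
Require Import Defs.
From Stdlib Require Import Classical_Prop.
From mathcomp Require Import all_boot all_order all_algebra all_fingroup.
From mathcomp Require Import ring.
Set Implicit Arguments.
Unset Strict Implicit.
Unset Printing Implicit Defensive.
Import GRing.Theory.
Local Open Scope ring_scope.

(** * Gluing maps along a disjoint union *)

Definition glue (A B T : Type) (f : A -> T) (g : B -> T) (x : A + B) : T :=
  match x with inl a => f a | inr b => g b end.

Definition ffglue (A B : finType) (T : Type) (f : {ffun A -> T})
  (g : {ffun B -> T}) : {ffun A + B -> T} := [ffun x => glue f g x].

Lemma sum_ffglue (F : fieldType) (A B V : finType) (G : {ffun A + B -> V} -> F) :
  \sum_z G z = \sum_(f : {ffun A -> V}) \sum_(g : {ffun B -> V}) G (ffglue f g).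
Proof.
rewrite pair_bigA /=.
pose h (p : {ffun A -> V} * {ffun B -> V}) := ffglue p.1 p.2.
pose h' (z : {ffun A + B -> V}) := ([ffun a => z (inl a)], [ffun b => z (inr b)]).
rewrite (reindex h) //; exists h' => [[f g]|z] _.
  by congr pair; apply/ffunP=> x; rewrite !ffunE.
by apply/ffunP=> -[a|b]; rewrite !ffunE /= ffunE.
Qed.

Lemma sum_ffun_unit (F : fieldType) (V : finType) (G : {ffun unit -> V} -> F) :
  \sum_z G z = \sum_(v : V) G [ffun=> v].
Proof.
rewrite (reindex (fun v : V => [ffun=> v] : {ffun unit -> V})) //.
exists (fun z : {ffun unit -> V} => z tt) => [v|z] _; first by rewrite ffunE.
by apply/ffunP=> -[]; rewrite ffunE.
Qed.

(** * Lists of edges *)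

Definition swap (T : Type) (e : T * T) := (e.2, e.1).

Lemma swapK (T : Type) : involutive (@swap T). Proof. by case. Qed.

Definition map_edge (T T' : Type) (h : T -> T') (e : T * T) := (h e.1, h e.2).

Lemma map_edge_inj (T T' : Type) (h : T -> T') :
  injective h -> injective (map_edge h).
Proof. by move=> hI [a b] [a' b'] [/hI-> /hI->]. Qed.

(* The uniqueness of [s ++ map swap s] excludes loops, repeated edges and
   pairs of opposite edges at once. *)
Definition simple_edges (L M : finType) (s : seq ((L + M) * (L + M))) : bool :=
  uniq (s ++ map (@swap _) s)
  && all (fun e => ~~ (is_inl e.1 && is_inl e.2)) s.

Lemma uniq_swap_map (T T' : eqType) (h : T -> T') (s : seq (T * T)) :
    injective h -> uniq (s ++ map (@swap _) s) ->
  uniq (map (map_edge h) s ++ map (@swap _) (map (map_edge h) s)).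
Proof.
move=> hI; rewrite -(map_inj_uniq (map_edge_inj hI)) map_cat.
by rewrite -!map_comp (eq_map (_ : map_edge h \o @swap _ =1 @swap _ \o map_edge h)).
Qed.

(** Every edge of [s] meets [p] and none of [t] does, so the lists stay disjoint under reversal of
    edges. In use, [p] consists of the unlabelled nodes private to [s]. *)
Lemma uniq_swap_cat (T : eqType) (p : pred T) (s t : seq (T * T)) :
    uniq (s ++ map (@swap _) s) -> uniq (t ++ map (@swap _) t) ->
    all (fun e => p e.1 || p e.2) s ->
    all (fun e => ~~ (p e.1 || p e.2)) t ->
  uniq ((s ++ t) ++ map (@swap _) (s ++ t)).
Proof.
move=> us ut ps pt.
have pm : perm_eq ((s ++ t) ++ map (@swap _) (s ++ t))
   ((s ++ map (@swap _) s) ++ (t ++ map (@swap _) t)).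
  rewrite map_cat -!catA perm_cat2l !catA perm_cat2r perm_catC //.
rewrite (perm_uniq pm) cat_uniq us ut andbT /=.
have ps2 : all (fun e => p e.1 || p e.2) (s ++ map (@swap _) s).
  rewrite all_cat ps all_map; apply: sub_all ps => e /=.
  by rewrite orbC.
have pt2 : all (fun e => ~~ (p e.1 || p e.2)) (t ++ map (@swap _) t).
  rewrite all_cat pt all_map; apply: sub_all pt => e /=.
  by rewrite orbC.
apply/hasPn => e /(allP pt2); apply: contra => /(allP ps2) //.
Qed.

(** * The algebra spanned by simple labelled graphs *)

Section Algebra.
Variables (F : fieldType) (d : bool) (H : wgraph F d).

Definition edges_weight (N : Type) (s : seq (N * N)) (psi : N -> H) : F :=
  \prod_(e <- s) eweight (psi e.1) (psi e.2).

Lemma edges_weight_map (N N' : Type) (h : N -> N') (psi : N' -> H)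
    (psi' : N -> H) (s : seq (N * N)) :
  psi \o h =1 psi' -> edges_weight (map (map_edge h) s) psi = edges_weight s psi'.
Proof.
by move=> E; rewrite /edges_weight big_map; apply: eq_bigr => e _; rewrite /= -!E.
Qed.

Lemma edges_weight_cat (N : Type) (s t : seq (N * N)) (psi : N -> H) :
  edges_weight (s ++ t) psi = edges_weight s psi * edges_weight t psi.
Proof. exact: big_cat. Qed.

Lemma eq_edges_weight (N : Type) (s : seq (N * N)) (psi psi' : N -> H) :
  psi =1 psi' -> edges_weight s psi = edges_weight s psi'.
Proof. by move=> E; apply: eq_bigr => e _; rewrite !E. Qed.

Definition verts_weight (M : finType) (eta : {ffun M -> H}) : F :=
  \prod_m vweight (eta m).

Lemma verts_weight_glue (M K : finType) (eta : {ffun M -> H}) (th : {ffun K -> H}) :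
  verts_weight (ffglue eta th) = verts_weight eta * verts_weight th.
Proof.
rewrite /verts_weight big_sumType /=.
by congr (_ * _); apply: eq_bigr => i _; rewrite ffunE.
Qed.

Lemma verts_weight_neq0 (M : finType) (eta : {ffun M -> H}) : verts_weight eta != 0.
Proof. by apply/prodf_neq0 => i _; apply: vweight_neq0. Qed.

(** The left summand holds the labelled nodes and the right one the unlabelled nodes, so no
    labelling map is needed; [hom_edges_lgraph] identifies this with [hom]. *)
Definition edges_hom (L M : finType) (s : seq ((L + M) * (L + M)))
    (phi : {ffun L -> H}) : F :=
  \sum_(eta : {ffun M -> H}) verts_weight eta * edges_weight s (glue phi eta).

(** The span $A_L$, over any finite type [L] so that labels can be added and forgotten. The last
    constructor stands in for function extensionality. *)
Inductive graph_fun (L : finType) : ({ffun L -> H} -> F) -> Prop :=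
| graph_fun_hom (M : finType) (s : seq ((L + M) * (L + M))) :
    simple_edges s -> graph_fun (edges_hom s)
| graph_fun0 : graph_fun (fun=> 0)
| graph_funD f g : graph_fun f -> graph_fun g -> graph_fun (fun phi => f phi + g phi)
| graph_funZ c f : graph_fun f -> graph_fun (fun phi => c * f phi)
| graph_fun_ext f g : f =1 g -> graph_fun f -> graph_fun g.

Lemma graph_fun1 (L : finType) : graph_fun (fun _ : {ffun L -> H} => 1).
Proof.
apply: (@graph_fun_ext L (edges_hom (M := void) [::])).
  move=> phi; rewrite /edges_hom.
  rewrite (eq_bigr (fun=> 1)) => [|eta _]; last first.
    rewrite /verts_weight /edges_weight big_nil mulr1.
    by apply: big1 => -[].
  by rewrite big_const card_ffun card_void expn0 /= addr0.
exact: graph_fun_hom.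
Qed.

(* The disjoint union of two graphs with the labelled nodes identified stays
   simple, because no edge joins two labelled nodes. *)
Lemma edges_homM (L M K : finType) (s : seq ((L + M) * (L + M)))
    (t : seq ((L + K) * (L + K))) :
    simple_edges s -> simple_edges t ->
  graph_fun (fun phi => edges_hom s phi * edges_hom t phi).
Proof.
case/andP=> us ls /andP[ut lt].
pose h (x : L + M) : L + (M + K) :=
  match x with inl i => inl i | inr m => inr (inl m) end.
pose h' (x : L + K) : L + (M + K) :=
  match x with inl i => inl i | inr m => inr (inr m) end.
have hI : injective h by move=> [a|a] [b|b] //= [->].
have h'I : injective h' by move=> [a|a] [b|b] //= [->].
apply: (@graph_fun_ext L (edges_hom (map (map_edge h) s ++ map (map_edge h') t))).
  move=> phi; rewrite /edges_hom sum_ffglue big_distrl /=.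
  apply: eq_bigr => eta _; rewrite big_distrr /=; apply: eq_bigr => th _.
  rewrite verts_weight_glue edges_weight_cat.
  rewrite (edges_weight_map (psi' := glue phi eta)); last first.
    by move=> [i|m] //=; rewrite ffunE.
  rewrite (edges_weight_map (psi' := glue phi th)); last first.
    by move=> [i|m] //=; rewrite ffunE.
  by rewrite mulrACA.
apply: graph_fun_hom; apply/andP; split.
  apply: (uniq_swap_cat (p := fun x => if x is inr (inl _) then true else false));
    rewrite ?uniq_swap_map //.
    by rewrite all_map; apply: sub_all ls => -[[a|a] [b|b]].
  by rewrite all_map; apply/allP => -[[a|a] [b|b]].
rewrite all_cat !all_map; apply/andP; split.
  by apply: sub_all ls => -[[a|a] [b|b]].
by apply: sub_all lt => -[[a|a] [b|b]].
Qed.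

(** By bilinearity, the product of two single graphs suffices. *)
Lemma graph_funM (L : finType) (f g : {ffun L -> H} -> F) :
  graph_fun f -> graph_fun g -> graph_fun (fun phi => f phi * g phi).
Proof.
move=> Af; elim=> [K t st||g1 g2 _ IH1 _ IH2|c g1 _ IH|g1 g2 E _ IH].
- elim: Af => [M s ss||f1 f2 _ IH1 _ IH2|c f1 _ IH|f1 f2 E _ IH].
  + exact: edges_homM.
  + by apply: graph_fun_ext (graph_fun0 L) => phi; rewrite mul0r.
  + by apply: graph_fun_ext (graph_funD IH1 IH2) => phi; rewrite mulrDl.
  + by apply: graph_fun_ext (graph_funZ c IH) => phi; rewrite mulrA.
  + by apply: graph_fun_ext IH => phi; rewrite E.
- by apply: graph_fun_ext (graph_fun0 L) => phi; rewrite mulr0.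
- by apply: graph_fun_ext (graph_funD IH1 IH2) => phi; rewrite mulrDr.
- by apply: graph_fun_ext (graph_funZ c IH) => phi; rewrite mulrCA.
- by apply: graph_fun_ext IH => phi; rewrite E.
Qed.

(* Relabels, adds edges and forgets the labels in [M]; since graphs for [f]
   have no edge inside [X], the new edges never double an old one. *)
Lemma graph_fun_unlabel (X P M : finType) (iota : X -> P + M)
    (s : seq ((P + M) * (P + M))) (f : {ffun X -> H} -> F) :
    injective iota -> simple_edges s -> graph_fun f ->
  graph_fun (fun phi => \sum_(eta : {ffun M -> H})
    verts_weight eta * edges_weight s (glue phi eta)
      * f [ffun x => glue phi eta (iota x)]).
Proof.
move=> iI /andP[us ls].
elim=> [K t /andP[ut lt]||f1 f2 _ IH1 _ IH2|c f1 _ IH|f1 f2 E _ IH].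
- pose j (x : P + M) : P + (M + K) :=
    match x with inl i => inl i | inr m => inr (inl m) end.
  pose h (x : X + K) : P + (M + K) :=
    match x with inl x => j (iota x) | inr k => inr (inr k) end.
  have jI : injective j by move=> [a|a] [b|b] //= [->].
  have jN x k : j x <> inr (inr k) by case: x.
  have hI : injective h.
    move=> [a|a] [b|b] /=; first by move/jI/iI->.
    + by move/jN.
    + by move/esym/jN.
    + by move=> [->].
  apply: (@graph_fun_ext P (edges_hom (map (map_edge h) t ++ map (map_edge j) s))).
    move=> phi; rewrite /edges_hom sum_ffglue /=.
    apply: eq_bigr => eta _; rewrite big_distrr /=; apply: eq_bigr => th _.
    rewrite verts_weight_glue edges_weight_cat.
    rewrite (edges_weight_map (psi' := glue [ffun x => glue phi eta (iota x)] th));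
      last first.
      by move=> [i|m] /=; rewrite ffunE //; case: (iota i) => //= m; rewrite ffunE.
    rewrite (edges_weight_map (psi' := glue phi eta)); last first.
      by move=> [i|m] //=; rewrite ffunE.
    by rewrite [edges_weight _ _ * edges_weight s _]mulrC mulrACA.
  apply: graph_fun_hom; apply/andP; split.
    apply: (uniq_swap_cat (p := fun x => if x is inr (inr _) then true else false));
      rewrite ?uniq_swap_map //.
      rewrite all_map; apply: sub_all lt => -[[a|a] [b|b]] //=.
      by rewrite orbT.
    by rewrite all_map; apply/allP => -[[a|a] [b|b]].
  rewrite all_cat !all_map; apply/andP; split.
    apply: sub_all lt => -[[a|a] [b|b]] //= _.
    by rewrite andbF.
  by apply: sub_all ls => -[[a|a] [b|b]].
- apply: graph_fun_ext (graph_fun0 P) => phi.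
  by rewrite big1 // => eta _; rewrite mulr0.
- apply: graph_fun_ext (graph_funD IH1 IH2) => phi.
  by rewrite -big_split; apply: eq_bigr => eta _; rewrite /= mulrDr.
- apply: graph_fun_ext (graph_funZ c IH) => phi.
  by rewrite big_distrr; apply: eq_bigr => eta _; rewrite /= mulrCA.
- apply: graph_fun_ext IH => phi.
  by apply: eq_bigr => eta _; rewrite E.
Qed.

(** * Star graphs *)

Definition orient (T : Type) (b : bool) (x y : T) := if b then (x, y) else (y, x).

Definition dweight (b : bool) (x y : H) : F :=
  if b then eweight x y else eweight y x.

(** The centre [inr tt] is the only unlabelled node; [o j] tells whether the ray at [j] leaves or
    enters it. *)
Definition star_edges (P : finType) (o : P -> bool) (J : seq P) :
  seq ((P + unit) * (P + unit)) := [seq orient (o j) (inr tt) (inl j) | j <- J].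

Lemma star_edges_simple (P : finType) (o : P -> bool) (J : seq P) :
  uniq J -> simple_edges (star_edges o J).
Proof.
move=> uJ; apply/andP; split; last first.
  by apply/allP => e /mapP[j _ ->]; rewrite /orient; case: (o j).
have oI : injective (fun j => orient (o j) (inr tt : P + unit) (inl j)).
  by move=> i j; rewrite /orient; case: (o i); case: (o j) => -[].
rewrite cat_uniq (map_inj_uniq (inv_inj (@swapK _))) (map_inj_uniq oI) uJ andbT /=.
apply/hasPn => e /mapP[e' /mapP[i _ ->] ->]; apply/mapP => -[j _].
rewrite /orient /swap; case oi: (o i); case oj: (o j) => //= -[] E;
  by move: oi; rewrite E oj.
Qed.

Lemma graph_fun_star (X P : finType) (iota : X -> P + unit) (o : P -> bool)
    (J : seq P) (f : {ffun X -> H} -> F) :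
    injective iota -> uniq J -> graph_fun f ->
  graph_fun (fun phi => \sum_(u : H)
    vweight u * (\prod_(j <- J) dweight (o j) u (phi j))
      * f [ffun x => glue phi (fun=> u) (iota x)]).
Proof.
move=> iI uJ Af.
apply: graph_fun_ext (graph_fun_unlabel iI (star_edges_simple o uJ) Af) => phi.
rewrite sum_ffun_unit; apply: eq_bigr => u _.
have E : glue phi ([ffun=> u] : {ffun unit -> H}) =1 glue phi (fun=> u).
  by move=> [x|x] //=; rewrite ffunE.
congr (_ * _ * _).
- rewrite /verts_weight (big_pred1 tt) => [|[]] //; by rewrite ffunE.
- rewrite (eq_edges_weight _ E) /edges_weight big_map; apply: eq_bigr => j _.
  by rewrite /orient /dweight; case: (o j).
- by congr f; apply/ffunP => x; rewrite !ffunE E.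
Qed.

(** Expanding the factor of [i] either adds the ray to [i] or multiplies by [- c i]. The list [J]
    collects the rays already chosen; as labels are distinct, the star stays simple. *)
Lemma graph_fun_star_poly (P : finType) (o : P -> bool) (c : P -> F) (I J : seq P) :
    uniq (J ++ I) ->
  graph_fun (fun phi => \sum_(u : H)
    vweight u * (\prod_(j <- J) dweight (o j) u (phi j))
      * \prod_(i <- I) (dweight (o i) u (phi i) - c i)).
Proof.
elim: I J => [|i I IH] J.
  rewrite cats0 => uJ.
  have vI : injective (fun x : void => inl (of_void P x) : P + unit) by case.
  apply: graph_fun_ext (graph_fun_star o vI uJ (graph_fun1 _)) => phi.
  by apply: eq_bigr => u _; rewrite big_nil.
move=> uJi.
have uiJ : uniq ((i :: J) ++ I) by move: uJi; rewrite -[i :: I]cat1s uniq_catCA.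
have uJ : uniq (J ++ I) by case/andP: uiJ.
apply: graph_fun_ext (graph_funD (IH _ uiJ) (graph_funZ (- c i) (IH _ uJ))) => phi.
rewrite big_distrr -big_split; apply: eq_bigr => u _ /=.
rewrite !big_cons; ring.
Qed.

(** * Indistinguishable labellings *)

Definition indist (L : finType) (phi psi : {ffun L -> H}) : Prop :=
  forall f, graph_fun f -> f phi = f psi.

Lemma indist_sym (L : finType) (phi psi : {ffun L -> H}) :
  indist phi psi -> indist psi phi.
Proof. by move=> E f Af; rewrite E. Qed.

Lemma indist_trans (L : finType) (phi psi chi : {ffun L -> H}) :
  indist phi psi -> indist psi chi -> indist phi chi.
Proof. by move=> E E' f Af; rewrite E // E'. Qed.

(** Multiply one function per labelling distinguishable from [phi], vanishing there and equal to 1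
    at [phi]. Being in the algebra, [e] is then 1 on the whole class. *)
Lemma class_indicator (L : finType) (phi : {ffun L -> H}) :
  exists e, [/\ graph_fun e, e phi = 1 & forall psi, e psi != 0 -> indist phi psi].
Proof.
suff [e [Ae e1 eP]] : exists e, [/\ graph_fun e, e phi = 1
    & forall psi, psi \in enum {ffun L -> H} -> e psi != 0 -> indist phi psi].
  by exists e; split=> // psi; apply: eP; rewrite mem_enum.
elim: (enum _) => [|psi s [e [Ae e1 eP]]].
  by exists (fun=> 1); split=> //; apply: graph_fun1.
case: (classic (indist phi psi)) => [E|N].
  exists e; split=> // chi; rewrite inE => /orP[/eqP->|] //; exact: eP.
have [g [Ag gN]] : exists g, graph_fun g /\ g phi <> g psi.
  apply: NNPP => nex; apply: N => f Af; apply: NNPP => fN; apply: nex.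
  by exists f.
have dN : g phi - g psi != 0 by rewrite subr_eq0; apply/eqP.
(* The new factor is the affine image of [g] with value 1 at [phi] and 0 at [psi]. *)
exists (fun chi => e chi * ((g phi - g psi)^-1 * (g chi + (- g psi) * 1))); split.
- apply: graph_funM => //; apply: graph_funZ; apply: graph_funD => //.
  by apply: graph_funZ; apply: graph_fun1.
- by rewrite e1 mul1r mulr1 mulVf.
- move=> chi; rewrite inE mulr1 => /orP[/eqP->|cs].
    by rewrite subrr !mulr0 eqxx.
  by rewrite mulf_eq0 negb_or => /andP[/(eP _ cs)].
Qed.

(** * Automorphisms from distinguishing labellings *)

Definition ext1 (L : finType) (phi : {ffun L -> H}) (v : H) : {ffun L + unit -> H} :=
  ffglue phi [ffun=> v].

Definition distinguishing (L : finType) (phi : {ffun L -> H}) : Prop :=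
  forall v w, indist (ext1 phi v) (ext1 phi w) -> v = w.

(** Forgets the last label after joining its node to [p]. With [p] a fresh label this compares edge
    weights of $H$; with [p] in [L] it compares weights towards [phi p]. *)
Lemma graph_fun_edge (L P : finType) (iota : L -> P) (b : bool) (p : P)
    (f : {ffun L + unit -> H} -> F) :
    injective iota -> graph_fun f ->
  graph_fun (fun phi => \sum_(u : H)
    vweight u * dweight b u (phi p) * f (ext1 [ffun i => phi (iota i)] u)).
Proof.
move=> iI Af.
pose i1 (x : L + unit) : P + unit := if x is inl i then inl (iota i) else inr tt.
have i1I : injective i1 by move=> [a|[]] [b'|[]] //= [/iI->].
apply: graph_fun_ext (graph_fun_star (fun=> b) i1I (_ : uniq [:: p]) Af) => // phi.
apply: eq_bigr => u _; rewrite big_seq1; congr (_ * f _).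
by apply/ffunP => -[x|x]; rewrite !ffunE /= !ffunE.
Qed.

Lemma graph_fun_sum1 (L : finType) (f : {ffun L + unit -> H} -> F) :
  graph_fun f ->
  graph_fun (fun phi => \sum_(u : H) vweight u * f (ext1 phi u)).
Proof.
move=> Af; apply: graph_fun_ext (graph_fun_star xpredT (@inj_id _) (_ : uniq [::]) Af).
  move=> phi; apply: eq_bigr => u _; rewrite big_nil mulr1; congr (_ * f _).
  by apply/ffunP => -[x|x]; rewrite !ffunE /= ?ffunE.
by [].
Qed.

Lemma twin_free_eq (v w : H) : twin_free H ->
  (forall b u, dweight b u v = dweight b u w) -> v = w.
Proof.
move=> tf E; apply/eqP; apply: contra_notT tf => /eqP vw; exists v, w; split=> // l.
  exact: (E false).
exact: (E true).
Qed.

(** The indicator [e v] selects the term [u = v] of an unlabelled sum at [phi] and the term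
    [u = s v] at [psi]. Equating such sums transfers first vertex weights, then edge weights. *)
Lemma indist_distinguishing (L : finType) (phi psi : {ffun L -> H}) :
    twin_free H -> distinguishing phi -> indist phi psi ->
  exists2 s : {perm H}, s \in waut H & forall i, psi i = s (phi i).
Proof.
move=> tf D E.
have [e eP] := fin_all_exists (fun v => class_indicator (ext1 phi v)).
have eA v : graph_fun (e v) by case: (eP v).
have e1 v : e v (ext1 phi v) = 1 by case: (eP v).
have eN v chi : e v chi != 0 -> indist (ext1 phi v) chi by case: (eP v) => _ _; apply.
have e_phi v u : e v (ext1 phi u) = (u == v)%:R.
  have [->|uv] := eqVneq u v; first exact: e1.
  apply/eqP; apply: contra_neqT uv => /eN /D //.
have sum_phi v (g : H -> F) :
    \sum_u vweight u * g u * e v (ext1 phi u) = vweight v * g v.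
  rewrite (bigD1 v) //= e_phi eqxx mulr1 big1 ?addr0 // => u uv.
  by rewrite e_phi (negPf uv) mulr0.
(* The unlabelled sum at [psi] equals the one at [phi], which is [vweight v]; hence some term at
   [psi] survives. *)
have [s sP] : exists s : H -> H, forall v, indist (ext1 phi v) (ext1 psi (s v)).
  apply: (fin_all_exists (P := fun v w => indist (ext1 phi v) (ext1 psi w))) => v.
  have : \sum_u vweight u * e v (ext1 psi u) != 0.
    rewrite -(E _ (graph_fun_sum1 (eA v))).
    rewrite (eq_bigr (fun u => vweight u * 1 * e v (ext1 phi u))) => [|u _].
      by rewrite sum_phi mulr1 vweight_neq0.
    by rewrite mulr1.
  case: (pickP (fun u => e v (ext1 psi u) != 0)) => [u /eN|z]; first by exists u.
  rewrite big1 ?eqxx // => u _; move/negbFE/eqP: (z u) => ->; exact: mulr0.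
have sI : injective s.
  move=> v w svw; apply: D; apply: indist_trans (sP v) _; rewrite svw.
  exact: indist_sym.
(* By finiteness [s] is onto, so each [u] is [s] of some vertex and [D] applies at [phi]. *)
have e_psi v u : e v (ext1 psi u) = (u == s v)%:R.
  have [->|uv] := eqVneq u (s v); first by rewrite -(sP v _ (eA v)).
  apply/eqP; apply: contra_neqT uv => /eN.
  rewrite -{1}(f_invF sI u) => /indist_trans /(_ (indist_sym (sP _))) /D ->.
  by rewrite f_invF.
have sum_psi v (g : H -> F) :
    \sum_u vweight u * g u * e v (ext1 psi u) = vweight (s v) * g (s v).
  rewrite (bigD1 (s v)) //= e_psi eqxx mulr1 big1 ?addr0 // => u uv.
  by rewrite e_psi (negPf uv) mulr0.
have sV v : vweight (s v) = vweight v.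
  have := E _ (graph_fun_sum1 (eA v)).
  under eq_bigr => u _ do rewrite -[vweight u]mulr1.
  rewrite sum_phi; under eq_bigr => u _ do rewrite -[vweight u]mulr1.
  by rewrite sum_psi !mulr1.
have sE b v w : dweight b v w = dweight b (s v) (s w).
  have := sP w _ (graph_fun_edge b (inr tt) (@inl_inj L unit) (eA v)).
  rewrite (eq_bigr (fun u => vweight u * dweight b u w * e v (ext1 phi u)));
    last first.
    move=> u _; rewrite !ffunE /= ffunE; congr (_ * e v (ext1 _ _)).
    by apply/ffunP => i; rewrite !ffunE.
  rewrite sum_phi.
  rewrite (eq_bigr (fun u => vweight u * dweight b u (s w) * e v (ext1 psi u)));
    last first.
    move=> u _; rewrite !ffunE /= ffunE; congr (_ * e v (ext1 _ _)).
    by apply/ffunP => i; rewrite !ffunE.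
  by rewrite sum_psi sV; apply: mulfI; apply: vweight_neq0.
have sL b v i : dweight b v (phi i) = dweight b (s v) (psi i).
  have := E _ (graph_fun_edge b i (@inj_id L) (eA v)).
  have idE (chi : {ffun L -> H}) : [ffun i => chi i] = chi.
    by apply/ffunP => j; rewrite ffunE.
  rewrite !idE sum_phi sum_psi sV; apply: mulfI; exact: vweight_neq0.
exists (perm sI).
  rewrite inE; apply/andP; split; apply/forallP => v; first by rewrite permE sV.
  by apply/forallP => w; rewrite !permE; apply/eqP/esym/(sE true).
(* As [s] is onto, [psi i] and [s (phi i)] have equal weights with every vertex. *)
move=> i; apply: twin_free_eq => // b u; rewrite permE -(f_invF sI u).
by rewrite -sE -sL.
Qed.

(** * Labels that make every labelling distinguishing *)

Lemma separator (tf : twin_free H) (a c : H) :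
  exists x : H * bool, a != c -> dweight x.2 a x.1 != dweight x.2 c x.1.
Proof.
(* Arbitrary value on the diagonal, so that a choice function on all pairs exists. *)
have [->|ac] := eqVneq a c; first by exists (c, true).
case: (pickP (fun x : H * bool => dweight x.2 a x.1 != dweight x.2 c x.1)) => [x xP|z].
  by exists x.
case: tf; exists a, c; split; first exact/eqP.
  by move=> l; apply/eqP/negbFE/(z (l, true)).
by move=> l; apply/eqP/negbFE/(z (l, false)).
Qed.

(** Label [(a, c)] sits at a vertex telling [a] from [c]. A star using the labels [(a, c)] forces
    its centre onto [a]; one more ray, to the last label, then reads off [dweight b a v]. *)
Lemma distinguishing_ext : twin_free H ->
  exists eta : {ffun H * H -> H},
    forall (L : finType) (phi : {ffun L -> H}), distinguishing (ffglue phi eta).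
Proof.
move=> tf.
have [x xP] := fin_all_exists (fun p : H * H => separator tf p.1 p.2).
exists [ffun p => (x p).1] => L phi v w E.
apply: twin_free_eq => // b a.
pose P := ((L + (H * H)) + unit)%type.
pose lab (c : H) : P := inl (inr (a, c)).
pose o (p : P) := if p is inl (inr q) then (x q).2 else b.
(* Subtracting the value at [c] kills the centre [c]; the default 0 is never reached. *)
pose k (p : P) := if p is inl (inr q) then dweight (x q).2 q.2 (x q).1 else 0.
pose cs := [seq c <- enum H | a != c].
have uJ : uniq ([:: inr tt : P] ++ map lab cs).
  have labI : injective lab by move=> c c' [].
  rewrite cat1s cons_uniq (map_inj_uniq labI) filter_uniq ?enum_uniq // andbT.
  by apply/mapP => -[].
have := E _ (graph_fun_star_poly o k uJ).
(* Lagrange-type product: zero at every [u] other than [a], nonzero at [a]. *)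
pose p u := \prod_(c <- cs) (dweight (x (a, c)).2 u (x (a, c)).1
                               - dweight (x (a, c)).2 c (x (a, c)).1).
have pa : p a != 0.
  rewrite prodf_seq_neq0; apply/allP => c; rewrite mem_filter => /andP[ac _] /=.
  by rewrite subr_eq0; exact: (xP (a, c)).
have p0 u : u != a -> p u = 0.
  move=> ua; apply/eqP; rewrite prodf_seq_eq0; apply/hasP; exists u.
    by rewrite mem_filter eq_sym ua mem_enum.
  by rewrite subrr eqxx.
have val z : \sum_u vweight u * (\prod_(j <- [:: inr tt : P])
     dweight (o j) u (ext1 (ffglue phi [ffun p => (x p).1]) z j)) *
     \prod_(i <- map lab cs)
        (dweight (o i) u (ext1 (ffglue phi [ffun p => (x p).1]) z i) - k i)
   = vweight a * dweight b a z * p a.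
  transitivity (\sum_u vweight u * dweight b u z * p u).
    apply: eq_bigr => u _; rewrite big_seq1 big_map !ffunE /= ffunE; congr (_ * _).
    by apply: eq_bigr => c _; rewrite !ffunE /= !ffunE /= !ffunE.
  rewrite (bigD1 a) //= big1 ?addr0 // => u /p0 ->; exact: mulr0.
rewrite !val => /(mulIf pa); apply: mulfI; exact: vweight_neq0.
Qed.

(** * The classes are the orbits *)

Lemma verts_weight_aut (M : finType) (s : {perm H}) (eta eta' : {ffun M -> H}) :
  s \in waut H -> (forall m, eta' m = s (eta m)) -> verts_weight eta' = verts_weight eta.
Proof.
rewrite inE => /andP[/forallP sV _] E; apply: eq_bigr => m _.
by rewrite E (eqP (sV _)).
Qed.

Lemma indist_orbit (L : finType) (phi psi : {ffun L -> H}) :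
    [pchar F] =i pred0 -> twin_free H -> indist phi psi ->
  exists2 s : {perm H}, s \in waut H & forall i, psi i = s (phi i).
Proof.
move=> ch tf E; have [eta0 D] := distinguishing_ext tf.
have sep (chi : {ffun L -> H}) eta : indist (ffglue phi eta0) (ffglue chi eta) ->
    exists2 s : {perm H}, s \in waut H
      & (forall i, chi i = s (phi i)) /\ (forall q, eta q = s (eta0 q)).
  case/(indist_distinguishing tf (D _ phi)) => s sA sP; exists s => //.
  by split=> x; [have := sP (inl x) | have := sP (inr x)]; rewrite !ffunE.
have [e [Ae e1 eP]] := class_indicator (ffglue phi eta0).
have Ag : graph_fun (fun chi : {ffun L -> H} =>
    \sum_(eta : {ffun H * H -> H}) verts_weight eta * e (ffglue chi eta)).
  have sn : simple_edges ([::] : seq ((L + (H * H)) * (L + (H * H)))) by [].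
  apply: graph_fun_ext (graph_fun_unlabel (@inj_id _) sn Ae) => chi.
  by apply: eq_bigr => eta _; rewrite /edges_weight big_nil mulr1.
have := E _ Ag; rewrite /=.
set gphi := LHS; move=> gE.
have gN : gphi != 0.
  (* Surviving [eta] are translates of [eta0] by automorphisms, with equal weight and [e] equal to
     1. The sum is this weight times a positive count, nonzero in characteristic 0. *)
  have -> : gphi = verts_weight eta0 *+ #|[pred eta | e (ffglue phi eta) != 0]|.
    rewrite -sumr_const /gphi (bigID (fun eta => e (ffglue phi eta) != 0)) /=.
    rewrite [X in _ + X]big1 ?addr0 => [|eta /negbNE/eqP->]; last exact: mulr0.
    apply: eq_bigr => eta eN.
    rewrite -(eP _ eN _ Ae) e1 mulr1.
    have [s sA [_ sE]] := sep _ _ (eP _ eN); exact: verts_weight_aut sA sE.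
  rewrite -mulr_natr mulf_neq0 ?verts_weight_neq0 //.
  rewrite (proj1 (pcharf0P F) ch) -lt0n; apply/card_gt0P; exists eta0.
  by rewrite inE e1 oner_neq0.
case: (pickP (fun eta => e (ffglue psi eta) != 0)) => [eta /eP/sep[s sA [sE _]]|z].
  by exists s.
move: gN; rewrite gE big1 ?eqxx // => eta _.
move/negbFE/eqP: (z eta) => ->; exact: mulr0.
Qed.

(** An invariant [f] is constant on classes, so it can be interpolated one labelling at a time,
    adding a multiple of a class indicator. *)
Lemma aut_invariant_graph_fun (L : finType) (f : {ffun L -> H} -> F) :
    [pchar F] =i pred0 -> twin_free H ->
    (forall s : {perm H}, s \in waut H ->
       forall phi : {ffun L -> H}, f [ffun i => s (phi i)] = f phi) ->
  graph_fun f.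
Proof.
move=> ch tf fI.
have fE phi psi : indist phi psi -> f psi = f phi.
  case/(indist_orbit ch tf) => s sA sE; rewrite -(fI s sA phi).
  by congr f; apply/ffunP => i; rewrite ffunE sE.
suff [g Ag gE] : exists2 g, graph_fun g
    & forall psi, psi \in enum {ffun L -> H} -> g psi = f psi.
  by apply: graph_fun_ext Ag => psi; rewrite gE ?mem_enum.
elim: (enum _) => [|psi r [g Ag gE]]; first by exists (fun=> 0) => //; apply: graph_fun0.
have [e [Ae e1 eP]] := class_indicator psi.
(* If the class of [psi] already meets [r], then [g] is right at [psi]; otherwise the correction
   vanishes on [r]. *)
case: (boolP (has (fun chi => e chi != 0) r)) => [/hasP[chi cr /eP E]|/hasPn z].
  exists g => // chi'; rewrite inE => /orP[/eqP->|/gE //].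
  by rewrite (E _ Ag) gE // (fE _ _ E).
exists (fun chi => g chi + (f psi - g psi) * e chi).
  by apply: graph_funD => //; apply: graph_funZ.
move=> chi; rewrite inE => /orP[/eqP->|cr]; first by rewrite e1 mulr1 addrC subrK.
by rewrite gE //; move/negbNE/eqP: (z _ cr) => ->; rewrite mulr0 addr0.
Qed.

End Algebra.

(** * Edge lists as labelled graphs *)

Section Realization.
Variables (F : fieldType) (d : bool) (H : wgraph F d) (k : nat) (M : finType).
Variable s : seq (('I_k + M) * ('I_k + M)).

(** An undirected edge is listed once, in either order, so both orders are looked up. *)
Definition edge_mult (u v : 'I_k + M) : nat :=
  ((u, v) \in s) || ~~ d && ((v, u) \in s).

Hypothesis simple_s : simple_edges s.

Lemma mem_swap_simple e : e \in s -> swap e \notin s.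
Proof.
case/andP: simple_s; rewrite cat_uniq => /and3P[_ /hasPn sN _] _ es.
by apply: sN; rewrite map_f.
Qed.

Lemma edge_mult_loopless u : edge_mult u u = 0%N.
Proof.
have N : (u, u) \notin s by apply/negP => /[dup] /mem_swap_simple /negP.
by rewrite /edge_mult (negPf N) andbF.
Qed.

Lemma edge_mult_sym : ~~ d -> forall u v, edge_mult u v = edge_mult v u.
Proof. by move=> nd u v; rewrite /edge_mult nd orbC. Qed.

Definition edges_lgraph : lgraph d k :=
  @LGraph d k ('I_k + M)%type inl edge_mult (@inl_inj _ _) edge_mult_loopless
    edge_mult_sym.

Lemma edges_lgraph_simple : simple_lgraph edges_lgraph.
Proof.
split=> /=.
  rewrite /edge_mult; case: (d) => u v /=; last by case: (_ || _).
  rewrite !orbF; case: (boolP ((u, v) \in s)) => [/mem_swap_simple /= /negPf->|_] //.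
  by case: (_ \in s).
move=> i j; case/andP: simple_s => _ /allP sL.
have N x y : (inl x, inl y) \notin s by apply/negP => /sL.
by rewrite /edge_mult !(negPf (N _ _)) andbF.
Qed.

Lemma edges_weight_slots (psi : 'I_k + M -> H) :
  \prod_(e : ('I_k + M) * ('I_k + M) | edge_slot d e)
     eweight (psi e.1) (psi e.2) ^+ edge_mult e.1 e.2 = edges_weight s psi.
Proof.
have us : uniq s by case/andP: simple_s; rewrite cat_uniq => /and3P[].
rewrite /edges_weight /edge_slot /edge_mult.
have [dT|nd] := orP (orbN d).
  have dF : ~~ d = false by rewrite dT.
  rewrite (big_uniq _ us) /= [RHS]big_mkcond.
  apply: eq_big => [e|[u v] _] /=; first by rewrite dT.
  by rewrite dF orbF; case: (_ \in s).
pose slot (e : ('I_k + M) * ('I_k + M)) := (enum_rank e.1 < enum_rank e.2)%N.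
pose g (e : ('I_k + M) * ('I_k + M)) := eweight (psi e.1) (psi e.2).
have gC e : g (swap e) = g e by rewrite /g eweight_sym.
have slot_swap e : e \in s -> slot (swap e) = ~~ slot e.
  case: e => u v es; rewrite /slot /= -leqNgt ltn_neqAle.
  have [E|//] := eqVneq (val (enum_rank v)) (enum_rank u).
  move/val_inj/enum_rank_inj: E es => -> /[dup] es /mem_swap_simple.
  by rewrite /swap es.
(* Edges listed in slot order and edges listed against it are counted separately; reversing the
   latter keeps their symmetric weight. *)
transitivity ((\prod_(e | slot e && (e \in s)) g e)
               * \prod_(e | slot e && (swap e \in s)) g e).
  rewrite (eq_bigl slot) => [|e]; last by rewrite (negPf nd).
  rewrite !big_mkcondr -big_split; apply: eq_bigr => -[u v] _ /=.
  rewrite nd; case: (boolP ((u, v) \in s)) => [/mem_swap_simple/negPf -> | _] /=.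
    by rewrite mulr1.
  by rewrite mul1r; case: ifP.
rewrite (big_uniq _ us) [RHS](bigID slot) /=; congr (_ * _).
  by apply: eq_bigl => e; rewrite andbC.
rewrite (reindex_inj (inv_inj (@swapK _))) /=.
apply: eq_big => [e|e _]; last exact: gC.
rewrite swapK andbC; case: (boolP (e \in s)) => //= es; exact: slot_swap.
Qed.

Lemma hom_edges_lgraph (phi : {ffun 'I_k -> H}) :
  Defs.hom phi edges_lgraph = edges_hom s phi.
Proof.
rewrite /Defs.hom /edges_hom /=.
(* Only maps whose restriction to the labels is [phi] contribute. *)
rewrite big_mkcond sum_ffglue (bigD1 phi) //= [X in _ + X]big1 ?addr0; last first.
  move=> phi' nphi; apply: big1 => eta _; case: forallP => // E.
  case/eqP: nphi; apply/ffunP => i; move: (E i); rewrite ffunE; exact/eqP.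
apply: eq_bigr => eta _; case: forallP => [_|[]]; last first.
  by move=> i; rewrite ffunE.
congr (_ * _).
  rewrite big_sumType /= big1 ?mul1r => [|i]; last by rewrite codom_f.
  apply: eq_big => [m|m _]; last by rewrite ffunE.
  by apply/codomP => -[].
rewrite edges_weight_slots; apply: eq_edges_weight => x; exact: ffunE.
Qed.

End Realization.

(** * From graph functions to columns *)

Lemma graph_fun_column (F : fieldType) (d : bool) (H : wgraph F d) (k : nat)
    (f : {ffun 'I_k -> H} -> F) :
  graph_fun f -> column_combination (@Nmx F d k H) (@simple_lgraph d k) f.
Proof.
elim=> [M s ss||f1 f2 _ [n1 [c1 [g1 [S1 E1]]]] _ [n2 [c2 [g2 [S2 E2]]]]
  |c f1 _ [n [c1 [g1 [S1 E1]]]]|f1 f2 E _ [n [c1 [g1 [S1 E1]]]]].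
- exists 1%N, (fun=> 1), (fun=> edges_lgraph d ss); split.
    by move=> _; apply: edges_lgraph_simple.
  by move=> phi; rewrite big_ord1 mul1r /Nmx hom_edges_lgraph.
- have g0 : 'I_0 -> lgraph d k by case.
  exists 0%N, (fun=> 0), g0.
  by split=> [[]|phi] //; rewrite big_ord0.
- exists (n1 + n2)%N, (fun i => glue c1 c2 (split i)),
    (fun i => glue g1 g2 (split i)).
  split=> [i|phi]; first by case: (split i) => j /=.
  rewrite E1 E2 big_split_ord /=; congr (_ + _); apply: eq_bigr => i _.
    by rewrite -[lshift _ _]/(unsplit (inl i)) unsplitK.
  by rewrite -[rshift _ _]/(unsplit (inr i)) unsplitK.
- exists n, (fun i => c * c1 i), g1; split=> // phi.
  by rewrite E1 big_distrr; apply: eq_bigr => i _; rewrite /= mulrA.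
- by exists n, c1, g1; split=> // phi; rewrite -E.
Qed.

(** Composition with [s] permutes the maps from [G] and preserves all weights. *)
Lemma hom_aut (F : fieldType) (d : bool) (H : wgraph F d) (k : nat)
    (G : lgraph d k) : aut_invariant (fun phi : {ffun 'I_k -> H} => Defs.hom phi G).
Proof.
move=> s; rewrite inE => /andP[/forallP sV /forallP sE] phi; rewrite /Defs.hom.
pose a (p : {ffun G -> H}) : {ffun G -> H} := [ffun u => s (p u)].
have aI : injective a.
  by move=> p q /ffunP E; apply/ffunP => u; move: (E u); rewrite !ffunE => /perm_inj.
rewrite (reindex_inj aI); apply: eq_big => [p|p _].
  by apply: eq_forallb => i; rewrite !ffunE (inj_eq perm_inj).
congr (_ * _); apply: eq_bigr => u _; rewrite !ffunE; first exact/eqP.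
by rewrite (eqP (forallP (sE _) _)).
Qed.

Theorem theorem8p4 (F : fieldType) (charF0 : [pchar F] =i pred0)
    (d : bool) (H : wgraph F d) (twinfreeH : twin_free H) (k : nat) :
  (forall f : {ffun 'I_k -> H} -> F,
     column_space (@Nmx F d k H) f <-> aut_invariant f)
  /\
  (forall f : {ffun 'I_k -> H} -> F,
     aut_invariant f ->
     column_combination (@Nmx F d k H) (@simple_lgraph d k) f).
Proof.
have simp (f : {ffun 'I_k -> H} -> F) : aut_invariant f ->
    column_combination (@Nmx F d k H) (@simple_lgraph d k) f.
  by move=> fI; apply/graph_fun_column/aut_invariant_graph_fun.
split=> // f; split=> [[n [c [g [_ E]]]] s sA phi|/simp [n [c [g [_ E]]]]].
  by rewrite !E; apply: eq_bigr => i _; rewrite /Nmx (hom_aut (g i) sA).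
by exists n, c, g.
Qed.
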